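(* Let $E\subset\mathbb{R}^n$ be a non-empty compact set. If $s\ge n$ then $$\underline{\dim}_{\rm B}^{\,s} E=\underline{\dim}_{\rm B} E\quad\text{and}\quad \overline{\dim}_{\rm B}^{\,s} E=\overline{\dim}_{\rm B} E .$$
   Context: For $s>0$ and $r>0$ let $\phi_r^s(x)=\min\{1,(r/|x|)^s\}$ for $x\in\mathbb{R}^n$ (with $\phi_r^s(0)=1$). For non-empty compact $E\subset\mathbb{R}^n$ let $\mathcal{M}(E)$ be the set of Borel probability measures supported by $E$. The capacity $C_r^s(E)$ is defined by $$\frac{1}{C_r^s(E)}=\inf_{\mu\in\mathcal{M}(E)}\int\int\phi_r^s(x-y)\,d\mu(x)\,d\mu(y).$$ The lower and upper $s$-box dimension profiles of $E$ are $$\underline{\dim}_{\rm B}^{\,s}E=\liminf_{r\to0}\frac{\log C_r^s(E)}{-\log r},\qquad \overline{\dim}_{\rm B}^{\,s}E=\limsup_{r\to0}\frac{\log C_r^s(E)}{-\log r}.$$ Let $N_r(E)$ be the minimum number of sets of diameter $r$ that can cover $E$. The lower and upper box-counting dimensions of $E$ are $$\underline{\dim}_{\rm B}E=\liminf_{r\to0}\frac{\log N_r(E)}{-\log r},\qquad \overline{\dim}_{\rm B}E=\limsup_{r\to0}\frac{\log N_r(E)}{-\log r}.$$ *)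

(* Defs.v *)
From HB Require Import structures.
From mathcomp Require Import all_boot all_order all_algebra.
From mathcomp Require Import all_classical all_reals all_analysis.

Set Implicit Arguments.
Unset Strict Implicit.
Unset Printing Implicit Defensive.

Import Order.TTheory GRing.Theory Num.Theory.
Import numFieldNormedType.Exports.

Local Open Scope classical_set_scope.
Local Open Scope ring_scope.

(* The library norm on 'rV[R]_n is the max norm; |x| here is Euclidean. *)
Definition enorm (R : realType) (n : nat) (x : 'rV[R]_n) : R :=
  Num.sqrt (\sum_(i < n) x ord0 i ^+ 2).

(* R^n with its Borel sigma-algebra. *)
Definition borel_rV (R : realType) (n : nat) :
    measurableType (@open 'rV[R]_n).-sigma :=
  g_sigma_algebraType (@open 'rV[R]_n).

(* The value at 0 has to be set by hand, since r / 0 = 0 in the library. *)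
Definition phi (R : realType) (n : nat) (s r : R) (x : 'rV[R]_n) : R :=
  if x == 0 then 1 else Num.min 1 ((r / enorm x) `^ s).

(* For closed E, the support of mu is contained in E iff mu (~` E) = 0. *)
Definition prob_on (R : realType) (n : nat) (E : set 'rV[R]_n) :
    set (probability (borel_rV R n) R) :=
  [set mu | mu (~` E) = 0%E].

Definition energy (R : realType) (n : nat) (s r : R)
    (mu : probability (borel_rV R n) R) : \bar R :=
  (\int[mu]_y \int[mu]_x (phi s r ((x : 'rV[R]_n) - y))%:E)%E.

Definition capacity (R : realType) (n : nat) (s r : R) (E : set 'rV[R]_n) :
    \bar R :=
  ((ereal_inf [set energy s r mu | mu in prob_on E])^-1)%E.

Definition diameter (R : realType) (n : nat) (U : set 'rV[R]_n) : \bar R :=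
  ereal_sup [set (enorm (xy.1 - xy.2))%:E | xy in U `*` U].

Definition covers (R : realType) (n : nat) (r : R) (E : set 'rV[R]_n)
    (k : nat) : Prop :=
  exists U : 'I_k -> set 'rV[R]_n,
    (forall i, diameter (U i) = r%:E) /\ E `<=` \bigcup_i U i.

(* The infimum of a non-empty set of naturals is its minimum; the value is
   +oo when there is no finite cover. *)
Definition covering_number (R : realType) (n : nat) (r : R)
    (E : set 'rV[R]_n) : \bar R :=
  ereal_inf [set (k%:R)%:E | k in covers r E].

Definition lower_dim_profile (R : realType) (n : nat) (s : R)
    (E : set 'rV[R]_n) : \bar R :=
  limf_einf (fun r : R => lne (capacity s r E) / (- ln r)%:E)%E 0^'+.

Definition upper_dim_profile (R : realType) (n : nat) (s : R)
    (E : set 'rV[R]_n) : \bar R :=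
  limf_esup (fun r : R => lne (capacity s r E) / (- ln r)%:E)%E 0^'+.

Definition lower_box_dim (R : realType) (n : nat) (E : set 'rV[R]_n) : \bar R :=
  limf_einf (fun r : R => lne (covering_number r E) / (- ln r)%:E)%E 0^'+.

Definition upper_box_dim (R : realType) (n : nat) (E : set 'rV[R]_n) : \bar R :=
  limf_esup (fun r : R => lne (covering_number r E) / (- ln r)%:E)%E 0^'+.

(* Main.v *)
Require Import Defs.
From HB Require Import structures.
From mathcomp Require Import all_boot all_order all_algebra.
From mathcomp Require Import all_classical all_reals all_analysis.
From mathcomp Require Import measurable_realfun ring lra.

(**
Write N_r for the covering number and C_r for the capacity of E at scale r.
At each scale the two numbers agree up to a constant and a power of
log (1/r); the logarithm of such a factor is negligible against log (1/r), so
the two quotients have the same lower and the same upper limit. Precisely: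

  C_r <= 4 * 2^s * N_r   and   N_r <= (c1 + c2 log (c3/r + 1))^n * C_r.

First inequality. Let a probability measure live on a set that k balls of
radius r cover. The balls of mass less than 1/(2k) carry at most half of the
total mass. Every point y of the other half lies in a ball of mass at
least 1/(2k), at all points x of which phi_r^s (x - y) >= 2^-s. So the energy
is at least 2^-s/(4k), for every k that is the size of a cover by sets of
diameter r ([energy_ge], [capacity_le_covers]).

Second inequality. Cut R^n into cubes of diameter r, hence of side
r / sqrt n, choose one point of E in each of the N cubes that meet E, and
let mu be the uniform probability measure on these points. The cubes cover E,
so N_r <= N. As s >= n and a norm dominates each coordinate,

  phi_r^s (x) <= min(1, r/|x|)^n <= prod_j min(1, r/|x_j|),

and for two points in the cubes of indices a and b the j-th factor is at most
(sqrt n + 2) / (|a_j - b_j| + 1) ([phi_le_prod], [kernel_grid]). The sum of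
this product over all indices a is a product of n one-dimensional sums, each
of them a harmonic sum over O(1/r) terms, hence O(log (1/r)). So the energy of
mu is O(log (1/r)^n / N) ([sum_phi_grid], [grid_measure]). The product bound
replaces the count of cubes at a given distance; it costs log^n where that
count would give log, which is harmless here.

The hypothesis s >= n is what makes the sums logarithmic.
*)

Set Implicit Arguments.
Unset Strict Implicit.
Unset Printing Implicit Defensive.

Import Order.TTheory GRing.Theory Num.Theory.
Import numFieldNormedType.Exports.

Local Open Scope classical_set_scope.
Local Open Scope ring_scope.

(** * Comparison of upper and lower limits *)

Lemma limf_esup_le_eps {R : realType} {T : choiceType} {X : filteredType T}
    (F : set_system X) {FF : Filter F} (f g : X -> \bar R) :
  (forall e : R, 0 < e -> \forall x \near F, (f x <= g x + e%:E)%E) ->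
  (limf_esup f F <= limf_esup g F)%E.
Proof.
move=> fg; rewrite [leRHS]limf_esupE.
apply: le_ereal_inf_tmp => _ [V FV <-].
apply/lee_addgt0Pr => e e0; rewrite limf_esupE.
apply: ge_ereal_inf.
pose W := V `&` [set x | f x <= g x + e%:E]%E; exists (ereal_sup (f @` W)).
  by exists W => //; apply: filterI => //; exact: fg.
apply: ge_ereal_sup => _ [x [Vx fgx] <-].
apply: (le_trans fgx); apply: leeD => //.
by apply: ereal_sup_ubound; exists x.
Qed.

Lemma limf_einf_le_eps {R : realType} {T : choiceType} {X : filteredType T}
    (F : set_system X) {FF : Filter F} (f g : X -> \bar R) :
  (forall e : R, 0 < e -> \forall x \near F, (f x <= g x + e%:E)%E) ->
  (limf_einf f F <= limf_einf g F)%E.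
Proof.
move=> fg; rewrite /limf_einf leeN2; apply: limf_esup_le_eps => e e0.
apply: filterS (fg e e0) => x.
by rewrite /= -leeBlDr// leeNl fin_num_oppeD// oppeK.
Qed.

(** * The Euclidean norm and the kernel *)

Section Kernel.
Context {R : realType} {n : nat}.
Implicit Types (x y p : 'rV[R]_n) (r s : R).

Lemma coord_le_enorm x i : `|x ord0 i| <= enorm x.
Proof.
rewrite -sqrtr_sqr; apply: ler_wsqrtr.
by rewrite (bigD1 i)//= lerDl sumr_ge0// => j _; rewrite sqr_ge0.
Qed.

Lemma enorm_ge0 x : 0 <= enorm x. Proof. exact: sqrtr_ge0. Qed.

Lemma enorm_gt0 x : x != 0 -> 0 < enorm x.
Proof.
move=> x0; rewrite lt_def enorm_ge0 andbT; apply: contra x0 => /eqP e0.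
apply/eqP/rowP => i; rewrite mxE; apply/eqP; rewrite -normr_le0.
by rewrite -e0 coord_le_enorm.
Qed.

(** The quadratic form of the triangle inequality,
|x - y|^2 <= 2 |x - p|^2 + 2 |y - p|^2, is enough here and holds coordinate
by coordinate. *)
Lemma enorm_le_double r x y p : enorm (x - p) <= r -> enorm (y - p) <= r ->
  enorm (x - y) <= 2 * r.
Proof.
move=> xp yp; have r0 : 0 <= r := le_trans (enorm_ge0 _) xp.
have sq z : enorm z <= r -> \sum_(i < n) z ord0 i ^+ 2 <= r ^+ 2.
  move=> zr; rewrite -[leLHS]sqr_sqrtr ?sumr_ge0// => [|i _]; last exact: sqr_ge0.
  by rewrite ler_sqr// nnegrE ?enorm_ge0.
rewrite -[leRHS]ger0_norm ?mulr_ge0// -sqrtr_sqr; apply: ler_wsqrtr.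
apply: (@le_trans _ _
  (\sum_(i < n) (2 * (x - p) ord0 i ^+ 2 + 2 * (y - p) ord0 i ^+ 2))).
  apply: ler_sum => i _; rewrite !mxE; rewrite -subr_ge0.
  have := sqr_ge0 (x ord0 i + y ord0 i - 2 * p ord0 i); rewrite !expr2; lra.
rewrite big_split/= -!mulr_sumr; have := sq _ xp; have := sq _ yp.
rewrite exprMn; lra.
Qed.

Lemma powR_le1 (a s : R) : 0 <= a <= 1 -> 0 <= s -> a `^ s <= 1.
Proof.
move=> /andP[a0 a1] s0; have := @ge0_ler_powR R s s0 a 1.
by rewrite !nnegrE a0 ler01 powR1; apply.
Qed.

(** For |x| <= r, in particular at 0, the base is 1, so one formula covers all
cases; it is a composition of continuous functions. *)
Lemma phi_max s r x : 0 < r -> 0 <= s ->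
  phi s r x = (r / Num.max r (enorm x)) `^ s.
Proof.
move=> r0 s0; rewrite /phi; case: eqP => [->|/eqP x0].
  have -> : enorm (0 : 'rV[R]_n) = 0.
    by rewrite /enorm big1 ?sqrtr0// => i _; rewrite mxE expr0n.
  by rewrite max_l ?ltW// divff ?gt_eqF// powR1.
have e0 := enorm_gt0 x0.
have [rx|xr] := leP r (enorm x).
  rewrite min_r// powR_le1// divr_ge0 ?(ltW r0) ?(ltW e0)//=.
  by rewrite ler_pdivrMr// mul1r.
rewrite divff ?gt_eqF// powR1 min_l//.
have := @ge0_ler_powR R s s0 1 (r / enorm x).
rewrite powR1 !nnegrE ler01 divr_ge0 ?(ltW r0) ?(ltW e0)//=; apply => //.
by rewrite ler_pdivlMr// mul1r ltW.
Qed.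

Lemma phi_ge0 s r x : 0 <= phi s r x.
Proof. by rewrite /phi; case: ifP => // _; rewrite le_min ler01 powR_ge0. Qed.

Lemma phi_ge s r x : 0 < r -> 0 <= s -> enorm x <= 2 * r ->
  2^-1 `^ s <= phi s r x.
Proof.
move=> r0 s0 xr; rewrite phi_max//.
have m0 : 0 < Num.max r (enorm x) by rewrite lt_max r0.
rewrite ge0_ler_powR ?nnegrE ?invr_ge0 ?divr_ge0 ?(ltW m0) ?(ltW r0)//.
rewrite ler_pdivlMr// ler_pdivrMl// ge_max xr andbT; lra.
Qed.

(** A base in [0, 1] makes the power decrease in the exponent, so s may be
replaced by n; each of the n factors is then bounded through one coordinate.
The product form is what lets the energy of a grid measure factor into
one-dimensional sums. *)
Lemma phi_le_prod s r x : 0 < r -> n%:R <= s ->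
  phi s r x <= \prod_(i < n) (r / Num.max r `|x ord0 i|).
Proof.
move=> r0 ns; rewrite phi_max//; last exact: le_trans ns.
have m0 t : 0 < Num.max r t by rewrite lt_max r0.
apply: (@le_trans _ _ ((r / Num.max r (enorm x)) `^ n%:R)).
  apply: ger_powR => //; rewrite divr_gt0//= ler_pdivrMr// mul1r.
  by rewrite le_max lexx.
rewrite powR_mulrn ?divr_ge0 ?(ltW (m0 _)) ?(ltW r0)//.
rewrite (_ : _ ^+ n = \prod_(i < n) (r / Num.max r (enorm x))); last first.
  by rewrite prodr_const card_ord.
apply: ler_prod => i _.
rewrite divr_ge0 ?(ltW (m0 _)) ?(ltW r0)//=.
rewrite ler_pM2l// lef_pV2 ?posrE//.
by rewrite ge_max !le_max lexx/= coord_le_enorm orbT.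
Qed.

(** * Borel sets and measurability *)

Lemma open_borel (U : set 'rV[R]_n) : open U ->
  measurable (U : set (borel_rV R n)).
Proof. by move=> oU; exact: sub_sigma_algebra. Qed.

Lemma measurable_fun_continuous (f : 'rV[R]_n -> R) : continuous f ->
  measurable_fun setT (f : borel_rV R n -> R).
Proof.
move=> cf; apply: (measurability _ (RGenOpens.measurableE R)).
move=> _ [_ [a [b ->] <-]]; rewrite setTI; apply: open_borel.
by apply: open_comp => // x _; exact: cf.
Qed.

Lemma continuous_enorm p : continuous (fun x => enorm (x - p)).
Proof.
move=> x; apply: (@continuous_comp _ _ _ _ (@Num.sqrt R));
  last exact: sqrt_continuous.
apply: cvg_big => [||i _]; [exact: add_continuous|exact: nbhs_filter|].
have h : {for x, continuous (fun x' : 'rV[R]_n => (x' - p) ord0 i)}.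
  rewrite (_ : (fun _ => _) = fun x' : 'rV[R]_n => x' ord0 i - p ord0 i).
    apply: (@cvgB _ R^o _ (nbhs x) _ (fun x' : 'rV[R]_n => x' ord0 i)
      (fun=> p ord0 i)).
      exact: coord_continuous.
    exact: cvg_cst.
  by apply/funext => x'; rewrite !mxE.
exact: (@continuous_comp _ _ _ _ (fun t : R => t ^+ 2) x h
  (@exprn_continuous _ 2 _)).
Qed.

Lemma measurable_phi s r p : 0 < r -> 0 <= s ->
  measurable_fun setT (fun x : borel_rV R n => phi s r ((x : 'rV[R]_n) - p)).
Proof.
move=> r0 s0; under eq_fun do rewrite phi_max//.
apply: (@measurableT_comp _ _ _ _ _ _ (@powR R ^~ s)); first exact: measurable_powR.
apply: measurable_fun_continuous => x.
have m0 : 0 < Num.max r (enorm (x - p)) by rewrite lt_max r0.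
apply: (@cvgM _ _ (nbhs x) _ (fun=> r)
  (fun x' : 'rV[R]_n => (Num.max r (enorm (x' - p)))^-1)).
  exact: cvg_cst.
apply: (@cvgV _ _ (nbhs x) _ (fun x' : 'rV[R]_n => Num.max r (enorm (x' - p)))).
  by rewrite gt_eqF.
apply: (@continuous_max _ _ (fun=> r) (fun x' : 'rV[R]_n => enorm (x' - p)) x).
  exact: cst_continuous.
exact: continuous_enorm.
Qed.

Lemma closed_ball_borel r p :
  measurable ([set x | enorm (x - p) <= r] : set (borel_rV R n)).
Proof.
have := measurable_fun_continuous (@continuous_enorm p).
move=> /(_ measurableT `]-oo, r]%classic (measurable_itv _)).
by rewrite setTI; congr measurable; apply/seteqP; split => x /=; rewrite in_itv.
Qed.

End Kernel.

(** * Integrals and measures *)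

(** The integral of any nonnegative function is the supremum of the integrals of
the simple functions below it, and a larger function has more of them. The
application is to the potential y |-> \int phi (x - y) dmu(x) of a measure,
taken as an arbitrary function. *)
Lemma ge0_integral_mono d (T : measurableType d) (R : realType)
    (mu : {measure set T -> \bar R}) (f g : T -> \bar R) :
  (forall x, 0 <= f x)%E -> (forall x, f x <= g x)%E ->
  (\int[mu]_x f x <= \int[mu]_x g x)%E.
Proof.
move=> f0 fg; rewrite !ge0_integralTE// => [|x]; last exact: le_trans (fg x).
apply: ge_ereal_sup => _ [h hf <-]; apply: ereal_sup_ubound; exists h => //.
by move=> x; exact: le_trans (fg x).
Qed.

Lemma integral_ge_cst d (T : measurableType d) (R : realType)
    (mu : {measure set T -> \bar R}) (f : T -> \bar R) (A : set T) (c : R) :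
  measurable A -> 0 <= c -> (forall x, 0 <= f x)%E ->
  (forall x, A x -> c%:E <= f x)%E ->
  (c%:E * mu A <= \int[mu]_x f x)%E.
Proof.
move=> mA c0 f0 cf; rewrite -integral_cst// integral_mkcond/=.
apply: ge0_integral_mono => x; rewrite patchE; case: ifPn => //.
by rewrite inE => /cf.
Qed.

Lemma measure_bigsetU_le d (T : measurableType d) (R : realType)
    (mu : {measure set T -> \bar R}) (I : Type) (l : seq I) (P : pred I)
    (A : I -> set T) :
  (forall i, measurable (A i)) ->
  (mu (\big[setU/set0]_(i <- l | P i) A i) <= \sum_(i <- l | P i) mu (A i))%E.
Proof.
move=> mA; elim: l => [|i l ih]; first by rewrite !big_nil measure0.
rewrite !big_cons; case: ifP => // _; apply: (le_trans (measureU2 _ _ _)) => //.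
  exact: bigsetU_measurable.
exact: leeD.
Qed.

(** The mean of the Dirac masses at the points p a, given through what is used
of it: its null sets and its integrals. *)
Lemma uniform_probability d (T : measurableType d) (R : realType) (I : finType)
    (A : {set I}) (p : I -> T) :
  A != finset.set0 -> exists mu : probability T R,
    (forall U : set T, (forall a, a \in A -> ~ U (p a)) -> mu U = 0%E) /\
    forall f : T -> R, measurable_fun setT f -> (forall x, 0 <= f x) ->
      (\int[mu]_x (f x)%:E = (#|A|%:R^-1 * \sum_(a in A) f (p a))%:E)%E.
Proof.
move=> /finset.set0Pn[a0 Aa0].
have N0 : #|A|%:R != 0 :> R by rewrite pnatr_eq0 -lt0n; apply/card_gt0P; exists a0.
have Nge : 0 <= #|A|%:R^-1 :> R by rewrite invr_ge0.
pose p' i := p (nth a0 (enum A) i).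
pose m := mscale (NngNum Nge) (msum (fun i => [the measure T R of \d_(p' i)]) #|A|).
have m1 : m setT = 1%E.
  rewrite /m /mscale/= /msum (eq_bigr (fun=> 1%E)) => [|i _]; last exact: diracT.
  by rewrite sumEFin -EFinM sumr_const card_ord mulVf.
pose H := Measure_isProbability.Build _ T R m m1.
pose mu : probability T R := HB.pack m H.
exists mu; split.
  move=> U Up; rewrite /mu/= /m /mscale/= /msum big1 ?mule0// => i _.
  rewrite [LHS]diracE memNset//; apply: Up.
  by rewrite -mem_enum mem_nth// -cardE.
move=> f mf f0; rewrite /mu/= /m.
have mf' : measurable_fun setT (EFin \o f) by exact/measurable_EFinP.
rewrite (@ge0_integral_mscale _ _ _ _ setT measurableT _ (EFin \o f))//=; last first.
  by move=> x _; rewrite lee_fin.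
rewrite (@ge0_integral_measure_sum _ _ _ _ setT measurableT (EFin \o f))//=; last first.
  by move=> x _; rewrite lee_fin.
rewrite EFinM; congr (_ * _)%E.
rewrite (eq_bigr (fun i : 'I__ => (f (p' i))%:E)) => [|i _]; last first.
  by rewrite integral_dirac//= diracT mul1e.
rewrite sumEFin; congr (_%:E).
by rewrite -[RHS]big_enum/= (big_nth a0) big_mkord -cardE.
Qed.

(** * Lower bound for the energy *)

Section EnergyLowerBound.
Context {R : realType} {n : nat}.

(** Balls of mass below 1/(2k) have total mass at most 1/2. The union H of the
others thus has mass at least 1/2, and on H the potential of mu is at least
2^-s / (2k), because two points of one ball are at distance at most 2r. *)
Lemma energy_ge (E : set 'rV[R]_n) (mu : probability (borel_rV R n) R) k
    (p : 'I_k -> 'rV[R]_n) (r s : R) :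
  0 < r -> 0 <= s -> (0 < k)%N -> measurable (E : set (borel_rV R n)) ->
  E `<=` \bigcup_i [set x | enorm (x - p i) <= r] ->
  prob_on E mu -> ((2^-1 `^ s / (4 * k%:R))%:E <= energy s r mu)%E.
Proof.
move=> r0 s0 k0 mE EA muE.
pose A i : set (borel_rV R n) := [set x | enorm ((x : 'rV[R]_n) - p i) <= r].
have mA i : measurable (A i) by exact: closed_ball_borel.
have kr : 0 < k%:R :> R by rewrite ltr0n.
pose eps : R := (2 * k%:R)^-1.
have eps0 : 0 < eps by rewrite invr_gt0 mulr_gt0.
(* The light balls form L, the heavy ones H. *)
pose light i := (mu (A i) < eps%:E)%E.
pose L := \big[setU/set0]_(i < k | light i) A i.
pose H := \big[setU/set0]_(i < k | ~~ light i) A i.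
have mL : measurable L by exact: bigsetU_measurable.
have mH : measurable H by exact: bigsetU_measurable.
have muL : (mu L <= 2^-1%:E)%E.
  apply: le_trans (measure_bigsetU_le _ _ _ mA) _.
  apply: (@le_trans _ _ (\sum_(i < k) eps%:E)%E).
    rewrite big_mkcond/=; apply: lee_sum => i _; case: ifPn => [/ltW//|_].
    by rewrite lee_fin ltW.
  rewrite sumEFin lee_fin sumr_const card_ord -(mulr_natr eps) /eps invfM -mulrA.
  by rewrite mulVf ?mulr1// gt_eqF.
have muH : (2^-1%:E <= mu H)%E.
  have : (1%:E <= mu (~` E `|` (L `|` H)))%E.
    rewrite -(@probability_setT _ _ _ mu); apply: le_measure; rewrite ?inE//.
      by apply: measurableU => //; [exact: measurableC|exact: measurableU].
    move=> x _; have [Ex|] := pselect (E x); last by left.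
    right; have [i _ Aix] := EA x Ex.
    by case/boolP: (light i) => li; [left|right]; rewrite /L /H (bigD1 i)//=; left.
  move=> h.
  have := le_trans h (measureU2 mu (measurableC mE) (measurableU _ _ mL mH)).
  rewrite [X in (X + _)%E](_ : _ = 0%E); last exact: muE.
  rewrite add0e => /le_trans/(_ (measureU2 mu mL mH)).
  move=> /le_trans/(_ (leeD2r _ muL)); rewrite -leeBlDl//; apply: le_trans.
  by rewrite -EFinB lee_fin; lra.
have inner y : H y -> ((2^-1 `^ s * eps)%:E <=
    \int[mu]_x (phi s r ((x : 'rV[R]_n) - y))%:E)%E.
  rewrite /H -bigcup_seq_cond => -[i /= /andP[_ hi] Aiy].
  apply: (@le_trans _ _ ((2^-1 `^ s)%:E * mu (A i))%E).
    by rewrite EFinM lee_wpmul2l ?lee_fin ?powR_ge0// leNgt.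
  apply: integral_ge_cst => //.
    by move=> x; rewrite lee_fin phi_ge0.
  move=> x Aix; rewrite lee_fin; apply: phi_ge => //; exact: enorm_le_double Aix Aiy.
rewrite /energy.
apply: (@le_trans _ _ ((2^-1 `^ s * eps)%:E * mu H)%E); last first.
  apply: integral_ge_cst => //; first by rewrite mulr_ge0 ?powR_ge0 ?ltW.
  by move=> y; apply: integral_ge0 => x _; rewrite lee_fin phi_ge0.
apply: (@le_trans _ _ ((2^-1 `^ s * eps)%:E * 2^-1%:E)%E).
  rewrite -EFinM lee_fin -mulrA ler_wpM2l ?powR_ge0//.
  rewrite /eps -invfM lef_pV2 ?posrE ?mulr_gt0//.
  lra.
by rewrite lee_wpmul2l// lee_fin mulr_ge0 ?powR_ge0 ?ltW.
Qed.

End EnergyLowerBound.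

(** * One-dimensional sums over the grid *)

Section GridSums.
Context {R : realType}.

(** The inductive step is 1/m <= ln m - ln (m - 1), which is
ln (1 - 1/m) <= - 1/m. *)
Lemma harmonic_sum_le (K : nat) :
  \sum_(t < K.+1) (t%:R + 1)^-1 <= 1 + ln K.+1%:R :> R.
Proof.
elim: K => [|K ih]; first by rewrite big_ord1 ln1 addr0 add0r invr1.
rewrite big_ord_recr/=.
have K1 : 0 < K.+1%:R :> R by [].
have K2 : 0 < K.+2%:R :> R by [].
have e : K.+2%:R = K.+1%:R + 1 :> R by rewrite -[K.+2]addn1 natrD.
have h : (K.+1%:R + 1)^-1 <= ln K.+2%:R - ln K.+1%:R :> R.
  have x1 : -1 < - K.+2%:R^-1 :> R by rewrite ltrN2 invf_lt1// ltr1n.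
  have := le_ln1Dx x1.
  have -> : 1 + - K.+2%:R^-1 = K.+1%:R / K.+2%:R :> R.
    have -> : K.+1%:R = K.+2%:R - 1 :> R by rewrite e addrK.
    by rewrite mulrBl divff ?gt_eqF// mul1r.
  by rewrite ln_div ?posrE// e; lra.
by move: ih h; lra.
Qed.

(** On either side of a the distances to a are distinct naturals, so each side
contributes at most the harmonic sum. *)
Lemma sum_dist_le (K : nat) (a : 'I_K.+1) :
  \sum_(b < K.+1) (`|a%:R - b%:R| + 1)^-1 <= 2 * (1 + ln K.+1%:R) :> R.
Proof.
have aK : (a <= K.+1)%N by exact/ltnW/ltn_ord.
have head m : (m <= K.+1)%N ->
    \sum_(0 <= t < m) (t%:R + 1)^-1 <= \sum_(t < K.+1) (t%:R + 1)^-1 :> R.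
  move=> mK; rewrite -[leRHS](big_mkord xpredT (fun t => (t%:R + 1)^-1)).
  rewrite [leRHS](big_cat_nat (leq0n m) mK)/= lerDl sumr_ge0//.
apply: (@le_trans _ _ (2 * \sum_(t < K.+1) (t%:R + 1)^-1)); last first.
  by rewrite ler_pM2l// harmonic_sum_le.
rewrite -(big_mkord xpredT (fun b => (`|a%:R - b%:R| + 1)^-1)).
rewrite (big_cat_nat (leq0n a) aK)//= mulrDl mul1r; apply: lerD.
  rewrite big_nat_rev/= add0n; apply: le_trans (head a aK).
  apply: ler_sum_nat => t /andP[_ ta].
  rewrite natrB// opprB addrCA subrr addr0 ger0_norm//.
  by rewrite lef_pV2 ?posrE ?ltr_wpDl// lerD2r ler_nat.
rewrite -{1}[nat_of_ord a]add0n big_addn.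
rewrite (eq_bigr (fun t => (t%:R + 1)^-1)) => [|t _]; last first.
  by rewrite natrD opprD addrCA subrr addr0 normrN ger0_norm.
exact/head/leq_subr.
Qed.

(** Distances of cell indices control distances of points up to one cell:
d (|a - b| + 1) <= |u - v| + 2 d. Multiplying by q, both terms on the right
are at most a constant times max (q d, |u - v|). *)
Lemma kernel_grid (q d u v : R) : 0 < q -> 0 < d -> 0 <= u -> 0 <= v ->
  (q * d) / Num.max (q * d) `|u - v| <=
  (q + 2) * (`|(Num.truncn (u / d))%:R - (Num.truncn (v / d))%:R| + 1)^-1.
Proof.
move=> q0 d0 u0 v0; set r := q * d.
have r0 : 0 < r by rewrite mulr_gt0.
set a := Num.truncn _; set b := Num.truncn _.
have fl w : 0 <= w -> let t := (Num.truncn (w / d))%:R : R in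
    t * d <= w /\ w < (t + 1) * d.
  move=> w0 /=.
  have /andP[] : (Num.truncn (w / d))%:R <= w / d < (Num.truncn (w / d)).+1%:R.
    by rewrite truncn_itv// divr_ge0// ltW.
  by rewrite ler_pdivlMr// ltr_pdivrMr// -natr1.
have [ua au] := fl u u0; have [vb bv] := fl v v0.
rewrite -/a in ua au; rewrite -/b in vb bv.
have m0 : 0 < Num.max r `|u - v| by rewrite lt_max r0.
have s0 : 0 < `|a%:R - b%:R| + 1 :> R by rewrite ltr_wpDl.
rewrite ler_pdivrMr// mulrAC ler_pdivlMr//.
have h : d * (`|a%:R - b%:R| + 1) <= `|u - v| + 2 * d.
  have := ler_norm (u - v); have := ler_norm (v - u); rewrite (distrC v).
  have [ab|ab] := ger0P (a%:R - b%:R : R); lra.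
apply: (@le_trans _ _ (q * (`|u - v| + 2 * d))).
  by rewrite /r -mulrA ler_pM2l.
rewrite [leLHS]mulrDr [leRHS]mulrDl; apply: lerD.
  by rewrite ler_pM2l// le_max lexx orbT.
by rewrite mulrCA ler_pM2l// le_max lexx.
Qed.

End GridSums.

(** * A measure of small energy *)

Section GridMeasure.
Context {R : realType} {n : nat}.
Implicit Types (x y p : 'rV[R]_n) (r s : R).

Lemma enormN x : enorm (- x) = enorm x.
Proof.
by rewrite /enorm; congr Num.sqrt; apply: eq_bigr => i _; rewrite mxE sqrrN.
Qed.

Lemma phiN s r x : phi s r (- x) = phi s r x.
Proof. by rewrite /phi enormN oppr_eq0. Qed.

Lemma diameter_cube (lo : 'rV[R]_n) (d : R) : (0 < n)%N -> 0 <= d ->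
  diameter [set x : 'rV[R]_n | forall j, lo ord0 j <= x ord0 j <= lo ord0 j + d]
  = (Num.sqrt n%:R * d)%:E.
Proof.
move=> n0 d0.
have diag : Num.sqrt n%:R * d = Num.sqrt (\sum_(j < n) d ^+ 2).
  by rewrite sumr_const card_ord -[d ^+ 2 *+ n]mulr_natl sqrtrM// sqrtr_sqr ger0_norm.
apply/eqP; rewrite eq_le; apply/andP; split.
  apply: ge_ereal_sup => _ [[x y] [/= xlo ylo] <-].
  rewrite lee_fin diag; apply: ler_wsqrtr; apply: ler_sum => j _.
  rewrite !mxE -[leLHS]real_normK ?num_real// ler_sqr ?nnegrE//.
  have /andP[? ?] := xlo j; have /andP[? ?] := ylo j.
  by rewrite ler_norml; apply/andP; split; lra.
apply: ereal_sup_ubound; exists (lo + const_mx d, lo).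
  by split => j /=; rewrite ?mxE lexx ?lerDl d0.
by congr (_%:E); rewrite diag /enorm; congr Num.sqrt; apply: eq_bigr => j _;
  rewrite !mxE addrAC subrr add0r.
Qed.

(** The sum over the occupied cells is at most the sum over all cells of the
grid, and there the sum of products is a product of sums. *)
Lemma sum_phi_grid (K : nat) (A : {set {ffun 'I_n -> 'I_K.+1}})
    (p : {ffun 'I_n -> 'I_K.+1} -> 'rV[R]_n) (q d L s : R) :
  0 < q -> 0 < d -> n%:R <= s ->
  (forall a j, a \in A -> 0 <= p a ord0 j + L /\
     (a j : nat) = Num.truncn ((p a ord0 j + L) / d)) ->
  forall b, b \in A ->
  \sum_(a in A) phi s (q * d) (p a - p b) <=
  ((q + 2) * (2 * (1 + ln K.+1%:R))) ^+ n.
Proof.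
move=> q0 d0 ns pA b Ab.
pose w (i j : 'I_K.+1) : R := (q + 2) * (`|i%:R - j%:R| + 1)^-1.
have w0 i j : 0 <= w i j.
  by rewrite mulr_ge0 ?addr_ge0 ?(ltW q0)// invr_ge0 addr_ge0.
apply: (@le_trans _ _ (\sum_(a in A) \prod_(j < n) w (a j) (b j))).
  apply: ler_sum => a Aa; apply: le_trans (phi_le_prod _ _ ns) _.
    by rewrite mulr_gt0.
  apply: ler_prod => j _; rewrite divr_ge0 ?le_max ?mulr_ge0 ?(ltW q0) ?(ltW d0)//=.
  rewrite /w; have [pa0 ->] := pA a j Aa; have [pb0 ->] := pA b j Ab.
  rewrite !mxE.
  have -> : p a ord0 j - p b ord0 j = (p a ord0 j + L) - (p b ord0 j + L) by ring.
  exact: kernel_grid.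
apply: (@le_trans _ _
  (\sum_(a : {ffun 'I_n -> 'I_K.+1}) \prod_(j < n) w (a j) (b j))).
  rewrite big_mkcond/=; apply: ler_sum => a _; case: ifP => // _.
  exact: prodr_ge0.
(* Each of the n coordinates contributes the same one-dimensional sum. *)
rewrite -(bigA_distr_bigA (fun j t => w t (b j)))/=.
rewrite -[X in _ <= _ ^+ X]card_ord -prodr_const; apply: ler_prod => j _.
rewrite sumr_ge0//= -mulr_sumr ler_pM2l ?addr_gt0//.
under eq_bigr do rewrite distrC.
exact: sum_dist_le.
Qed.

(** Cubes of side r / sqrt n have diameter exactly r. The N cubes that meet E
form a cover, and the uniform measure on one point of E per cube has small
energy: the same N serves for the covering number and for the energy. *)
Lemma grid_measure (E : set 'rV[R]_n) (r s L : R) : (0 < n)%N ->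
  E !=set0 -> 0 < r -> n%:R <= s ->
  (forall x j, E x -> `|x ord0 j| <= L) ->
  exists (N : nat) (mu : probability (borel_rV R n) R),
  [/\ (0 < N)%N, covers r E N, prob_on E mu &
   (energy s r mu <= (N%:R^-1 * ((Num.sqrt n%:R + 2) *
      (2 * (1 + ln (2 * L * Num.sqrt n%:R / r + 1)))) ^+ n)%:E)%E].
Proof.
move=> n0 [x0 Ex0] r0 ns EL.
have L0 : 0 <= L by apply: le_trans (EL x0 (Ordinal n0) Ex0).
set q := Num.sqrt n%:R.
have q0 : 0 < q by rewrite sqrtr_gt0 ltr0n.
have s0 : 0 <= s by apply: le_trans ns.
pose d := r / q.
have d0 : 0 < d by rewrite divr_gt0.
have rE : r = q * d by rewrite /d mulrC divfK ?gt_eqF.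
(* E lies in [-L, L]^n; after translation by L the cell indices are the naturals
   below K.+1. *)
pose K := Num.truncn (2 * L / d).
pose t (x : 'rV[R]_n) j := Num.truncn ((x ord0 j + L) / d).
have EL0 x j : E x -> 0 <= x ord0 j + L.
  by move=> Ex; have := EL x j Ex; rewrite ler_norml => /andP[? _]; lra.
have tK x j : E x -> (t x j < K.+1)%N.
  move=> Ex; rewrite ltnS; apply: le_truncn; rewrite ler_pM2r ?invr_gt0//.
  by have := EL x j Ex; rewrite ler_norml => /andP[_ ?]; lra.
pose cell x : {ffun 'I_n -> 'I_K.+1} := [ffun j => inord (t x j)].
have cellE x j : E x -> (cell x j : nat) = t x j.
  by move=> Ex; rewrite ffunE inordK ?tK.
pose A := [set a : {ffun 'I_n -> 'I_K.+1} | `[< exists2 x, E x & cell x = a >]]%SET.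
have /choice[p pP] : forall a, exists x, a \in A -> E x /\ cell x = a.
  move=> a; have [|aA] := boolP (a \in A); last by exists 0.
  by rewrite inE => /asboolP[x Ex xa]; exists x.
have A0 : A != finset.set0.
  apply/finset.set0Pn; exists (cell x0); rewrite inE; apply/asboolP; by exists x0.
have [mu [muE muf]] := @uniform_probability _ (borel_rV R n) R _ A p A0.
exists #|A|, mu; split.
- by rewrite card_gt0.
- pose lo (a : {ffun 'I_n -> 'I_K.+1}) : 'rV[R]_n := \row_j ((a j)%:R * d - L).
  exists (fun i => [set x : 'rV[R]_n | forall j,
     lo (enum_val i) ord0 j <= x ord0 j <= lo (enum_val i) ord0 j + d]).
  split=> [i|x Ex]; first by rewrite diameter_cube// ?(ltW d0)// rE.
  have Acx : cell x \in A by rewrite inE; apply/asboolP; exists x.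
  exists (enum_rank_in Acx (cell x)) => // j /=; rewrite enum_rankK_in// mxE cellE//.
  have : (t x j)%:R <= (x ord0 j + L) / d < (t x j).+1%:R.
    by rewrite truncn_itv// divr_ge0 ?EL0// ltW.
  rewrite ler_pdivlMr// ltr_pdivrMr// -natr1 => /andP[? ?].
  by apply/andP; split; lra.
- by apply: muE => a /pP[Epa _]; apply.
rewrite /energy.
have mphi y : measurable_fun setT (fun x : borel_rV R n => phi s r ((x : 'rV[R]_n) - y)).
  exact: measurable_phi.
under eq_integral => y _ do rewrite (muf _ (mphi y) (fun x => phi_ge0 _ _ _)).
pose F (y : borel_rV R n) : R := #|A|%:R^-1 * \sum_(a in A) phi s r (p a - y).
rewrite (muf F); last 2 first.
(* The kernel is even, so it is also measurable in its second argument. *)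
- apply: measurable_funM => //.
  under eq_fun do rewrite -big_enum/=; apply: measurable_sum => a.
  by under eq_fun do rewrite -phiN opprB; exact: measurable_phi.
- by move=> y; rewrite mulr_ge0 ?invr_ge0 ?sumr_ge0// => a _; rewrite phi_ge0.
rewrite lee_fin ler_pM2l ?invr_gt0 ?ltr0n ?card_gt0//.
rewrite /F -mulr_sumr ler_pdivrMl ?ltr0n ?card_gt0//.
rewrite [leRHS]mulr_natl -sumr_const.
apply: ler_sum => b Ab; rewrite [in leLHS]rE.
apply: le_trans (sum_phi_grid (L := L) q0 d0 ns _ Ab) _.
  move=> a j Aa; have [Epa cpa] := pP a Aa; split; first exact: EL0.
  by rewrite -[in LHS]cpa cellE.
have K1 : K.+1%:R <= 2 * L * q / r + 1.
  rewrite -natr1 lerD2r.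
  have -> : 2 * L * q / r = 2 * L / d by rewrite /d invfM invrK mulrA mulrAC.
  by rewrite truncn_le; apply: divr_ge0; [exact: mulr_ge0|exact: ltW].
have K0 : 1 <= K.+1%:R :> R by rewrite ler1n.
have q2 : 0 < q + 2 by rewrite addr_gt0.
have lnK : 0 <= ln K.+1%:R :> R by exact: ln_ge0.
have lnKM : ln K.+1%:R <= ln (2 * L * q / r + 1).
  by rewrite ler_ln ?posrE//; exact: lt_le_trans K1.
rewrite lerXn2r// ?nnegrE.
- by apply: mulr_ge0; [exact: ltW|rewrite mulr_ge0// addr_ge0].
- apply: mulr_ge0; [exact: ltW|rewrite mulr_ge0// addr_ge0//].
  exact: le_trans lnK lnKM.
by rewrite ler_pM2l// ler_pM2l// lerD2l.
Qed.

End GridMeasure.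

(** * Capacity and covering number at a fixed scale *)

Section FixedScale.
Context {R : realType} {n : nat}.
Implicit Types (r s : R) (E : set 'rV[R]_n).

Lemma capacity_le E s r c : 0 < c ->
  (forall mu, prob_on E mu -> (c%:E <= energy s r mu)%E) ->
  (capacity s r E <= c^-1%:E)%E.
Proof.
move=> c0 cE; rewrite /capacity.
have : (c%:E <= ereal_inf [set energy s r mu | mu in prob_on E])%E.
  by apply: le_ereal_inf_tmp => _ [mu /cE ? <-].
case: ereal_inf => [t| |]//=; last by move=> _; rewrite invey lee_fin invr_ge0 ltW.
rewrite lee_fin => ct; have t0 := lt_le_trans c0 ct.
by rewrite inver gt_eqF// lee_fin lef_pV2 ?posrE.
Qed.

Lemma energy_ge0 s r (mu : probability (borel_rV R n) R) : (0 <= energy s r mu)%E.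
Proof.
rewrite /energy; apply: integral_ge0 => y _; apply: integral_ge0 => x _.
by rewrite lee_fin phi_ge0.
Qed.

Lemma capacity_ge E s r c (mu : probability (borel_rV R n) R) : 0 < c ->
  prob_on E mu -> (energy s r mu <= c%:E)%E -> (c^-1%:E <= capacity s r E)%E.
Proof.
move=> c0 muE muc; rewrite /capacity.
have : (ereal_inf [set energy s r mu | mu in prob_on E] <= c%:E)%E.
  by apply: ge_ereal_inf; exists (energy s r mu) => //; exists mu.
have : (0 <= ereal_inf [set energy s r mu | mu in prob_on E])%E.
  by apply: le_ereal_inf_tmp => _ [nu _ <-]; exact: energy_ge0.
case: ereal_inf => [t| |]//=.
rewrite !lee_fin inver => t0 tc; case: eqP => [_|/eqP tn0]; first exact: leey.
by rewrite lee_fin lef_pV2 ?posrE// lt_def tn0.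
Qed.

Lemma diameter_sub_ball (U : set 'rV[R]_n) r : diameter U = r%:E ->
  exists p, U `<=` [set x | enorm (x - p) <= r].
Proof.
move=> dU; have [[p Up]|U0] := pselect (U !=set0).
  exists p => x Ux /=; rewrite -lee_fin -dU.
  by apply: ereal_sup_ubound; exists (x, p).
by exists 0 => x Ux; case: U0; exists x.
Qed.

Lemma capacity_le_covers E s r k : 0 < r -> 0 <= s -> E !=set0 ->
  measurable (E : set (borel_rV R n)) -> covers r E k ->
  (capacity s r E <= ((4 / 2^-1 `^ s) * k%:R)%:E)%E.
Proof.
move=> r0 s0 [x0 Ex0] mE [U [dU EU]].
have k0 : (0 < k)%N by case: (EU _ Ex0) => i _ _; apply: leq_trans (ltn_ord i).
have /choice[p pU] i := diameter_sub_ball (dU i).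
have h0 : 0 < 2^-1 `^ s :> R by rewrite powR_gt0.
have -> : (4 / 2^-1 `^ s) * k%:R = (2^-1 `^ s / (4 * k%:R))^-1 :> R.
  by rewrite invfM invrK mulrAC mulrC.
apply: capacity_le => [|mu muE]; first by rewrite divr_gt0// mulr_gt0// ltr0n.
apply: (energy_ge (E := E) (p := p)) => // x /EU[i _ Uix].
by exists i => //; exact: pU.
Qed.

Lemma compact_borel E : compact E -> measurable (E : set (borel_rV R n)).
Proof.
move=> cE; rewrite -[E]setCK; apply: measurableC; apply: open_borel.
by apply: closed_openC; apply: compact_closed => //; exact: norm_hausdorff.
Qed.

Lemma compact_coord_bounded E : compact E ->
  exists2 L : R, 0 <= L & forall x j, E x -> `|x ord0 j| <= L.
Proof.
move=> /compact_bounded/ex_strict_bound_gt0[L /ltW L0 EL]; exists L => // x j Ex.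
apply: le_trans (ltW (EL x Ex)).
by rewrite [leRHS]mx_normrE; apply: (le_bigmax _ _ (ord0, j)).
Qed.

(** Both numbers are positive reals here, so that their logarithms can be
compared in R. *)
Lemma capacity_covering_number E s r L :
  (0 < n)%N -> E !=set0 -> compact E -> n%:R <= s ->
  0 < r -> 0 <= L -> (forall x j, E x -> `|x ord0 j| <= L) ->
  exists x y : R, [/\ 0 < x, 0 < y, capacity s r E = x%:E,
    covering_number r E = y%:E &
    x <= (4 / 2^-1 `^ s) * y /\
    y <= ((Num.sqrt n%:R + 2) *
      (2 * (1 + ln (2 * L * Num.sqrt n%:R / r + 1)))) ^+ n * x].
Proof.
move=> n0 E0 cE ns r0 L0 EL.
have s0 : 0 <= s by apply: le_trans ns.
have mE := compact_borel cE.
have [N [mu [N0 EN muE]]] := grid_measure n0 E0 r0 ns EL.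
set B := (X in _ * X); move=> muB.
have B0 : 0 < B.
  apply: exprn_gt0; apply: mulr_gt0; first by rewrite ltr_wpDl ?sqrtr_ge0.
  apply: mulr_gt0 => //; rewrite ltr_wpDr// ln_ge0// lerDr.
  by rewrite divr_ge0 ?mulr_ge0 ?sqrtr_ge0 ?(ltW r0).
have NR : 0 < N%:R :> R by rewrite ltr0n.
have NB : 0 < N%:R^-1 * B by rewrite mulr_gt0 ?invr_gt0.
have h0 : 0 < 4 / 2^-1 `^ s :> R by rewrite divr_gt0 ?powR_gt0.
have capN := capacity_le_covers r0 s0 E0 mE EN.
have capB := capacity_ge NB muE muB.
have capk k := @capacity_le_covers E s r k r0 s0 E0 mE.
have covN : (covering_number r E <= N%:R%:E)%E.
  by apply: ereal_inf_lbound; exists N.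
move: capN capB capk; case: (capacity s r E) => [x| |]//; rewrite !lee_fin.
move=> _ capB capk.
have x0 : 0 < x by apply: lt_le_trans capB; rewrite invr_gt0.
have : ((x / (4 / 2^-1 `^ s))%:E <= covering_number r E)%E.
  apply: le_ereal_inf_tmp => _ [k /capk + <-].
  by rewrite !lee_fin => xk; rewrite ler_pdivrMr// mulrC.
move: covN; case: (covering_number r E) => [y| |]//; rewrite !lee_fin => yN xy.
exists x, y; split => //; first by apply: lt_le_trans xy; rewrite divr_gt0.
split; first by rewrite mulrC -ler_pdivrMr.
apply: (le_trans yN); move: capB; rewrite invfM invrK ler_pdivrMr//.
by rewrite mulrC.
Qed.

End FixedScale.

(** * Passage to the limit *)

Section LogarithmNearZero.
Context {R : realType}.

(** The bound ln t < t applied to t = eta (a + u) gives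
ln (a + u) <= eta (a + u) - ln eta, of slope eta in u; eta is chosen so that
n eta <= e / 2, and the constants take up the other half of e u. *)
Lemma ln_affine_le_linear (a D e : R) (n : nat) : 0 < a -> 0 < e ->
  exists u0, forall u, u0 <= u -> 0 < u /\ D + n%:R * ln (a + u) <= e * u.
Proof.
move=> a0 e0.
(* The successor keeps eta finite for n = 0, the case of a constant. *)
pose m : R := n.+1%:R; have m0 : 0 < m by [].
pose eta := e / (2 * m).
have eta0 : 0 < eta by rewrite divr_gt0 ?mulr_gt0.
pose D' := D + n%:R * (eta * a - ln eta).
exists (Num.max 1 (2 * D' / e)) => u; rewrite ge_max => /andP[u1 uD].
have u0 : 0 < u by apply: lt_le_trans u1.
split=> //.
have au : 0 < a + u by rewrite addr_gt0.
have : ln (a + u) <= eta * (a + u) - ln eta.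
  have := ln_sublinear (mulr_gt0 eta0 au).
  by rewrite lnM ?posrE//; lra.
move=> /(ler_wpM2l (ler0n R n)) h.
move: uD; rewrite ler_pdivrMr// => uD.
have : n%:R * eta * u <= e / 2 * u.
  rewrite ler_pM2r// /eta [leLHS](_ : _ = (e / 2) * (n%:R / m)); last first.
    by field; rewrite gt_eqF.
  by rewrite ler_piMr ?divr_ge0 ?(ltW e0)// ler_pdivrMr// mul1r ler_nat.
rewrite /D' in uD; move: h uD; lra.
Qed.

Lemma near0_opp_ln_ge (u0 : R) : \forall r \near 0^'+, 0 < r /\ u0 <= - ln r.
Proof.
near=> r.
have r0 : 0 < r by near: r; exact: nbhs_right_gt.
split=> //; rewrite lerNr -[leRHS]expRK ler_ln ?posrE ?expR_gt0//.
near: r; apply: nbhs_right_le; exact: expR_gt0.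
Unshelve. all: by end_near. Qed.

End LogarithmNearZero.

Section Limit.
Context {R : realType} {n : nat}.

(** With u = - ln r, the factors between the capacity and the covering number
have logarithms O(1) and O(ln u), and these are at most e u for small r. *)
Lemma log_comparison (E : set 'rV[R]_n) (s : R) : (0 < n)%N ->
  E !=set0 -> compact E -> n%:R <= s ->
  forall e : R, 0 < e -> \forall r \near 0^'+,
  (lne (capacity s r E) / (- ln r)%:E <=
    lne (covering_number r E) / (- ln r)%:E + e%:E)%E /\
  (lne (covering_number r E) / (- ln r)%:E <=
    lne (capacity s r E) / (- ln r)%:E + e%:E)%E.
Proof.
move=> n0 E0 cE ns e e0.
have [L L0 EL] := compact_coord_bounded cE.
pose c1 : R := 4 / 2^-1 `^ s.
have c10 : 0 < c1 by rewrite divr_gt0 ?powR_gt0.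
pose c2 : R := (Num.sqrt n%:R + 2) * 2.
have c20 : 0 < c2 by rewrite mulr_gt0// ltr_wpDl ?sqrtr_ge0.
pose M := 2 * L * Num.sqrt n%:R.
have M0 : 0 <= M by rewrite !mulr_ge0 ?sqrtr_ge0.
have M1 : 0 <= ln (M + 1) by rewrite ln_ge0// lerDr.
have a0 : 0 < 1 + ln (M + 1) by rewrite ltr_wpDr.
have [u1 hu1] := @ln_affine_le_linear R 1 (ln c1) e 0 ltr01 e0.
have [u2 hu2] := @ln_affine_le_linear R _ (n%:R * ln c2) e n a0 e0.
near=> r.
have [r0 ru] : 0 < r /\ Num.max u1 u2 <= - ln r by near: r; exact: near0_opp_ln_ge.
move: ru; rewrite ge_max => /andP[/hu1[u0 h1] /hu2[_ h2]].
set u := - ln r in u0 h1 h2 *.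
have [x [y [x0 y0 -> -> [xy yx]]]] := capacity_covering_number n0 E0 cE ns r0 L0 EL.
rewrite !lne_EFin// !inver gt_eqF// -!EFinM -!EFinD !lee_fin.
have r1 : r <= 1.
  by rewrite -ler_ln ?posrE// ln1 -oppr_ge0 ltW.
have lnr : ln (M / r + 1) <= ln (M + 1) + u.
  have -> : u = ln r^-1 by rewrite lnV ?posrE.
  have M10 : 0 < M + 1 by rewrite ltr_wpDl.
  rewrite -lnM ?posrE ?invr_gt0// ler_ln ?posrE ?mulr_gt0 ?invr_gt0//
    ?ltr_wpDl ?divr_ge0 ?(ltW r0)//.
  by rewrite mulrDl mul1r lerD2l invf_ge1.
have lnMr0 : 0 <= ln (M / r + 1) by rewrite ln_ge0// lerDr divr_ge0 ?(ltW r0).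
have t0 : 0 < 1 + ln (M / r + 1) by rewrite ltr_wpDr.
have lx : ln x <= ln c1 + ln y.
  by rewrite -lnM ?posrE// ler_ln ?posrE// mulr_gt0.
have ly : ln y <= n%:R * ln c2 + n%:R * ln (1 + ln (M + 1) + u) + ln x.
  have Bt0 : 0 < c2 * (1 + ln (M / r + 1)) by rewrite mulr_gt0.
  have : ln y <= ln ((c2 * (1 + ln (M / r + 1))) ^+ n * x).
    by rewrite ler_ln ?posrE// ?mulr_gt0 ?exprn_gt0// /c2 -[_ * 2 * _]mulrA.
  move=> /le_trans; apply; rewrite lnM ?posrE ?exprn_gt0// lerD2r lnXn//.
  rewrite lnM ?posrE// -[(_ + _) *+ n]mulr_natl mulrDr lerD2l ler_wpM2l//.
  by rewrite ler_ln ?posrE ?(addr_gt0 a0 u0)//; move: lnr; lra.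
split; rewrite -[e](mulfK (lt0r_neq0 u0)) -mulrDl ler_pM2r ?invr_gt0//.
  by move: h1 lx; lra.
by move: h2 ly; lra.
Unshelve. all: by end_near. Qed.

End Limit.

Theorem corollary2p5 (R : realType) (n : nat) (n_gt0 : (0 < n)%N)
    (E : set 'rV[R]_n) (E_neq0 : E !=set0) (E_compact : compact E)
    (s : R) (s_ge_n : n%:R <= s) :
  lower_dim_profile s E = lower_box_dim E /\
  upper_dim_profile s E = upper_box_dim E.
Proof.
have h := log_comparison n_gt0 E_neq0 E_compact s_ge_n.
split; apply/eqP; rewrite eq_le; apply/andP; split.
- by apply: limf_einf_le_eps => e /h; apply: filterS => r [].
- by apply: limf_einf_le_eps => e /h; apply: filterS => r [].
- by apply: limf_esup_le_eps => e /h; apply: filterS => r [].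
- by apply: limf_esup_le_eps => e /h; apply: filterS => r [].
Qed.
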